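(* Let $\mathbb{F}$ be an algebraically closed field, $q\in\mathbb{F}$ with $q\neq 0$, and $f,g\in\mathbb{F}[h]$. Let $\lambda,\lambda'\in\mathsf{S}_f$, $\mu\in\mathsf{T}_{q,g,\lambda}$, $\mu'\in\mathsf{T}_{q,g,\lambda'}$ and $\gamma,\gamma'\in\mathbb{F}^*$, with $|\lambda|,|\lambda'|,|\mu|,|\mu'|\geq 1$. Then there is an isomorphism of $\mathcal{H}_q(f,g)$-modules $$\mathsf{A}_{q,f,g}(\lambda,\mu)/\mathbb{F}[t^{\pm1}](t^{|\lambda||\mu|}-\gamma)\simeq\mathsf{B}_{q,f,g}(\lambda',\mu')/\mathbb{F}[t^{\pm1}](t^{|\lambda'||\mu'|}-\gamma')$$ if and only if $\gamma=\gamma'\prod_{j=0}^{|\lambda||\mu|-1}\mu(j)$ and there exist $0\leq i<|\lambda|$, $0\leq j<|\mu|$ such that $\lambda'(k)=\lambda(k+i)$ and $\mu'(k)=\mu(k+i+j|\lambda|)$ for all $k\in\mathbb{Z}$.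
   Context: $\mathcal{H}_q(f,g)$ is the unital associative $\mathbb{F}$-algebra generated by $x,y,h$ with defining relations $hx=xf(h)$, $yh=f(h)y$, $yx-qxy=g(h)$; modules are left modules. $\mathsf{S}_f$ is the set of functions $\lambda:\mathbb{Z}\to\mathbb{F}$ with $f(\lambda(i))=\lambda(i+1)$ for all $i\in\mathbb{Z}$; for $\lambda\in\mathsf{S}_f$, $|\lambda|\geq 0$ is the nonnegative generator of the subgroup $\{k\in\mathbb{Z}\mid\lambda(i)=\lambda(i+k)\ \forall i\in\mathbb{Z}\}$ of $\mathbb{Z}$. For $\lambda\in\mathsf{S}_f$, $\mathsf{T}_{q,g,\lambda}$ is the set of functions $\mu:\mathbb{Z}\to\mathbb{F}$ with $\mu(i+1)=q\mu(i)+g(\lambda(i))$ for all $i\in\mathbb{Z}$; for $\mu\in\mathsf{T}_{q,g,\lambda}$ the set $\{k\in\mathbb{Z}\mid\mu(k|\lambda|)=\mu(0)\}$ is a subgroup of $\mathbb{Z}$ (as $q\ne0$), and $|\mu|\geq 0$ denotes its nonnegative generator. For $\lambda\in\mathsf{S}_f$, $\mu\in\mathsf{T}_{q,g,\lambda}$: $\mathsf{A}_{q,f,g}(\lambda,\mu)$ is the module with underlying space the Laurent polynomials $\mathbb{F}[t^{\pm1}]$ and action $ht^i=\lambda(i)t^i$, $xt^i=t^{i+1}$, $yt^i=\mu(i)t^{i-1}$ ($i\in\mathbb{Z}$); $\mathsf{B}_{q,f,g}(\lambda,\mu)$ is the module with underlying space $\mathbb{F}[t^{\pm1}]$ and action $ht^i=\lambda(i)t^i$,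 $xt^i=\mu(i+1)t^{i+1}$, $yt^i=t^{i-1}$ ($i\in\mathbb{Z}$). When $|\lambda|,|\mu|\ge1$ and $\gamma\in\mathbb{F}^*$, the subspace $\mathbb{F}[t^{\pm1}](t^{|\lambda||\mu|}-\gamma)$ (the ideal of $\mathbb{F}[t^{\pm1}]$ generated by $t^{|\lambda||\mu|}-\gamma$) is a submodule of both. *)

(* Defs.v *)
From HB Require Import structures.
From mathcomp Require Import all_boot all_order all_algebra.
From mathcomp Require Import finmap generic_quotient ring_quotient.
From mathcomp Require Import boolp classical_sets.
From mathcomp Require Import monalg.

Set Implicit Arguments.
Unset Strict Implicit.
Unset Printing Implicit Defensive.

Import GRing.Theory Num.Theory.

Local Open Scope quotient_scope.
Local Open Scope ring_scope.

Section QuotMod.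
Variables (R : pzRingType) (M : lmodType R) (N : submodClosed M).

(* The library's [submodClosed] does not record closure under opposite, which
   the quotient group asks for; over a ring it follows from -1 *: _. *)
Definition subgrp : {pred M} := fun v => v \in N.

Fact subgrp_zmod_closed : zmod_closed subgrp.
Proof.
split=> [|u v Nu Nv]; first exact: (rpred0 N).
by rewrite -scaleN1r; rewrite rpredD ?rpredZ.
Qed.
HB.instance Definition _ := GRing.isZmodClosed.Build M subgrp subgrp_zmod_closed.

Definition quotmod := Quotient.quot subgrp.
HB.instance Definition _ := GRing.Zmodule.on quotmod.
HB.instance Definition _ := EqQuotient.on quotmod.

Definition quotmod_pi (v : M) : quotmod := \pi_quotmod v.

Lemma quotmod_eq (u v : M) :
  (quotmod_pi u == quotmod_pi v) = (u - v \in N).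
Proof. by rewrite -[u - v \in N]/(u - v \in subgrp) Quotient.idealrBE. Qed.

Lemma quotmod_piD u v : quotmod_pi (u + v) = quotmod_pi u + quotmod_pi v.
Proof. exact: Quotient.pi_add. Qed.

Lemma quotmod_reprK (u : quotmod) : quotmod_pi (repr u) = u.
Proof. exact: reprK. Qed.

End QuotMod.

HB.lock Definition quotmod_scale (R : pzRingType) (M : lmodType R)
  (N : submodClosed M) (a : R) (u : quotmod N) : quotmod N :=
  quotmod_pi N (a *: repr u).

Section QuotMod.
Variables (R : pzRingType) (M : lmodType R) (N : submodClosed M).
Local Notation quotmod := (quotmod N).
Local Notation quotmod_pi := (quotmod_pi N).
Local Notation quotmod_scale := (@quotmod_scale R M N).

Lemma quotmod_piZ a v : quotmod_scale a (quotmod_pi v) = quotmod_pi (a *: v).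
Proof.
apply/eqP; rewrite quotmod_scale.unlock quotmod_eq -scalerBr; apply: rpredZ.
by rewrite -quotmod_eq quotmod_reprK.
Qed.

Fact quotmod_scalerA a b u :
  quotmod_scale a (quotmod_scale b u) = quotmod_scale (a * b) u.
Proof. by rewrite -[u]quotmod_reprK !quotmod_piZ scalerA. Qed.
Fact quotmod_scale1r : left_id 1 quotmod_scale.
Proof. by move=> u; rewrite -[u]quotmod_reprK quotmod_piZ scale1r. Qed.
Fact quotmod_scalerDr : right_distributive quotmod_scale +%R.
Proof.
move=> a u v; rewrite -[u]quotmod_reprK -[v]quotmod_reprK.
by rewrite -quotmod_piD !quotmod_piZ scalerDr quotmod_piD.
Qed.
Fact quotmod_scalerDl u : {morph quotmod_scale^~ u : a b / a + b}.
Proof.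
move=> a b; rewrite -[u]quotmod_reprK !quotmod_piZ.
by rewrite scalerDl quotmod_piD.
Qed.
HB.instance Definition _ := GRing.Zmodule_isLmodule.Build R quotmod
  quotmod_scalerA quotmod_scale1r quotmod_scalerDr quotmod_scalerDl.

Fact quotmod_pi_linear : linear quotmod_pi.
Proof. by move=> a u v; rewrite quotmod_piD -quotmod_piZ. Qed.
HB.instance Definition _ :=
  GRing.isLinear.Build R M quotmod _ quotmod_pi quotmod_pi_linear.

End QuotMod.

(* Free unital associative algebra on three letters.  The product is the one
   of the monoid algebra, locked so that failed unifications stay cheap. *)
Definition freealg3 (F : fieldType) := {malg F[{fmonom 'I_3}]}.

HB.lock Definition freealg3_mul (F : fieldType)
  (p r : {malg F[{fmonom 'I_3}]}) : {malg F[{fmonom 'I_3}]} := p * r.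

Section FreeAlg.
Variable F : fieldType.
Implicit Types (p r s : freealg3 F).

HB.instance Definition _ := GRing.Lmodule.on (freealg3 F).

Let mulE := @freealg3_mul.unlock.

Definition freealg3_one : freealg3 F := (1 : {malg F[{fmonom 'I_3}]}).

Fact freealg3_mulA : associative (@freealg3_mul F).
Proof. by rewrite mulE; apply: mulrA. Qed.
Fact freealg3_mul1r : left_id freealg3_one (@freealg3_mul F).
Proof. by rewrite mulE; apply: mul1r. Qed.
Fact freealg3_mulr1 : right_id freealg3_one (@freealg3_mul F).
Proof. by rewrite mulE; apply: mulr1. Qed.
Fact freealg3_mulDl : left_distributive (@freealg3_mul F) +%R.
Proof. by rewrite mulE; apply: mulrDl. Qed.
Fact freealg3_mulDr : right_distributive (@freealg3_mul F) +%R.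
Proof. by rewrite mulE; apply: mulrDr. Qed.
Fact freealg3_1_neq0 : freealg3_one != 0.
Proof. exact: (oner_neq0 {malg F[{fmonom 'I_3}]}). Qed.
HB.instance Definition _ := GRing.Zmodule_isNzRing.Build (freealg3 F)
  freealg3_mulA freealg3_mul1r freealg3_mulr1 freealg3_mulDl freealg3_mulDr
  freealg3_1_neq0.

Lemma freealg3ME p r :
  p * r = \sum_(i <- msupp p) \sum_(j <- msupp r) << p@_i * r@_j *g mmul i j >>.
Proof. by rewrite [LHS]/GRing.mul /= mulE. Qed.

Fact freealg3_scalerAl (c : F) p r :
  c *: freealg3_mul p r = freealg3_mul (c *: p) r.
Proof. by rewrite mulE; apply: scalerAl. Qed.
HB.instance Definition _ :=
  GRing.Lmodule_isLalgebra.Build F (freealg3 F) freealg3_scalerAl.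

Fact freealg3_scalerAr (c : F) p r :
  c *: freealg3_mul p r = freealg3_mul p (c *: r).
Proof.
rewrite mulE; suff E (u : {malg F[{fmonom 'I_3}]}) : c%:MP * u = u * c%:MP.
  by rewrite -[LHS]mul_malgC -[c *: r]mul_malgC [LHS]mulrA [RHS]mulrA E.
rewrite [LHS]fgmulUg [RHS]fgmulgU.
by apply: eq_bigr => k _; rewrite mul1m mulm1 mulrC.
Qed.
HB.instance Definition _ :=
  GRing.Lalgebra_isAlgebra.Build F (freealg3 F) freealg3_scalerAr.

Definition letter (i : 'I_3) : freealg3 F := << fmu i >>.
Definition Xf := letter 0.
Definition Yf := letter 1.
Definition Hf := letter 2.

Variables (q : F) (f g : {poly F}).

(* The two-sided ideal generated by the defining relations of H_q(f,g); scalars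
   need no clause of their own, c *: u being c%:A * u. *)
Inductive relideal : freealg3 F -> Prop :=
| relideal_hx : relideal (Hf * Xf - Xf * horner_alg Hf f)
| relideal_yh : relideal (Yf * Hf - horner_alg Hf f * Yf)
| relideal_yx : relideal (Yf * Xf - q *: (Xf * Yf) - horner_alg Hf g)
| relideal0 : relideal 0
| relidealD u v : relideal u -> relideal v -> relideal (u + v)
| relidealMl a u : relideal u -> relideal (a * u)
| relidealMr u a : relideal u -> relideal (u * a).

Definition relideal_pred : {pred freealg3 F} := fun u => `[< relideal u >].

Lemma relidealP u : reflect (relideal u) (u \in relideal_pred).
Proof. exact: asboolP. Qed.

Fact relideal_zmod_closed : zmod_closed relideal_pred.
Proof.
split=> [|u v /relidealP Iu /relidealP Iv]; apply/relidealP.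
  exact: relideal0.
by apply: relidealD => //; rewrite -mulN1r; apply: relidealMl.
Qed.
HB.instance Definition _ :=
  GRing.isZmodClosed.Build (freealg3 F) relideal_pred relideal_zmod_closed.

Definition peval (V : lmodType F) (p : {poly F}) (h : V -> V) (v : V) : V :=
  \sum_(i < size p) p`_i *: iter i h v.

(* A representation of H_q(f,g): a vector space with three operators obeying
   the defining relations. *)
Record hrep := HRep {
  hspace : lmodType F;
  opx : {linear hspace -> hspace};
  opy : {linear hspace -> hspace};
  oph : {linear hspace -> hspace};
  hrep_hx : forall v, oph (opx v) = opx (peval f oph v);
  hrep_yh : forall v, opy (oph v) = peval f oph (opy v);
  hrep_yx : forall v, opy (opx v) - q *: opx (opy v) = peval g oph v }.

Section Act.
Variable r : hrep.
Local Notation V := (hspace r).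

Definition opl (i : 'I_3) : {linear V -> V} :=
  match val i with 0%N => opx r | 1%N => opy r | _ => oph r end.

Definition wact (w : seq 'I_3) (v : V) : V := foldr opl v w.

Definition freeact (p : freealg3 F) (v : V) : V :=
  \sum_(w <- msupp p) p@_w *: wact w v.

Implicit Types (v : V).

Lemma wact_linear w : linear (wact w).
Proof.
by elim: w => // i w IH a u v; rewrite [LHS](congr1 (opl i) (IH a u v)) linearP.
Qed.
HB.instance Definition _ w :=
  GRing.isLinear.Build F V V _ (wact w) (wact_linear w).

Lemma freeactEw (d : {fset {fmonom 'I_3}}) p v : (msupp p `<=` d)%fset ->
  freeact p v = \sum_(w <- d) p@_w *: wact w v.
Proof.
move=> le; rewrite /freeact (big_fset_incl _ le) //= => k _ /mcoeff_outdom ->.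
by rewrite scale0r.
Qed.

Lemma freeactDl (p1 p2 : freealg3 F) v : freeact (p1 + p2) v = freeact p1 v + freeact p2 v.
Proof.
rewrite (freeactEw v (msuppD_le p1 p2)).
rewrite (freeactEw v (fsubsetUl (msupp p1) (msupp p2))).
rewrite (freeactEw v (fsubsetUr (msupp p1) (msupp p2))) -big_split /=.
by apply: eq_bigr => w _; rewrite mcoeffD scalerDl.
Qed.

Lemma freeactZl c p v : freeact (c *: p) v = c *: freeact p v.
Proof.
rewrite (freeactEw v (msuppZ_le c p)) /freeact scaler_sumr.
by apply: eq_bigr => w _; rewrite mcoeffZ scalerA.
Qed.

Lemma freeact0l v : freeact 0 v = 0.
Proof. by rewrite -(scale0r 0) freeactZl scale0r. Qed.

Lemma freeactBl (p1 p2 : freealg3 F) v : freeact (p1 - p2) v = freeact p1 v - freeact p2 v.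
Proof. by rewrite freeactDl -[- p2]scaleN1r freeactZl scaleN1r. Qed.

Lemma freeact_linear p : linear (freeact p).
Proof.
move=> a u v; rewrite /freeact scaler_sumr -big_split; apply: eq_bigr => w _ /=.
by rewrite wact_linear scalerDr !scalerA mulrC.
Qed.
HB.instance Definition _ p :=
  GRing.isLinear.Build F V V _ (freeact p) (freeact_linear p).

Lemma freeactU c w v : freeact << c *g w >> v = c *: wact w v.
Proof. by rewrite (freeactEw v msuppU_le) big_seq_fset1 mcoeffUU. Qed.

Lemma freeact_sum (I : Type) (s : seq I) (P : pred I) (G : I -> freealg3 F) v :
  freeact (\sum_(i <- s | P i) G i) v = \sum_(i <- s | P i) freeact (G i) v.
Proof. exact: (big_morph (freeact^~ v) (fun a b => freeactDl a b v) (freeact0l v)). Qed.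

Lemma freeactM (p1 p2 : freealg3 F) v : freeact (p1 * p2) v = freeact p1 (freeact p2 v).
Proof.
rewrite freealg3ME freeact_sum; apply: eq_bigr => w1 _.
rewrite freeact_sum [freeact p2 v]/freeact linear_sum scaler_sumr.
apply: eq_bigr => w2 _.
by rewrite freeactU linearZ scalerA /wact fmM foldr_cat.
Qed.

Lemma freeact1 v : freeact 1 v = v.
Proof. by rewrite freeactU scale1r /wact fm1. Qed.

Lemma freeact_letter i v : freeact (letter i) v = opl i v.
Proof. by rewrite freeactU scale1r /wact fmU. Qed.

Lemma freeactX i p v : freeact (p ^+ i) v = iter i (freeact p) v.
Proof.
by elim: i => [|i IH]; rewrite ?expr0 ?freeact1 // exprS freeactM IH.
Qed.

Lemma freeact_peval (p : {poly F}) v : freeact (horner_alg Hf p) v = peval p (oph r) v.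
Proof.
rewrite -[p in LHS]coefK poly_def linear_sum freeact_sum; apply: eq_bigr => i _.
rewrite linearZ /= mulr_algl freeactZl rmorphXn /= horner_algX freeactX; congr (_ *: _).
by apply: eq_iter => u; rewrite freeact_letter.
Qed.

Lemma freeact_relideal p : relideal p -> forall v, freeact p v = 0.
Proof.
have eX v := freeact_letter 0 v : freeact Xf v = opx r v.
have eY v := freeact_letter 1 v : freeact Yf v = opy r v.
have eH v := freeact_letter 2 v : freeact Hf v = oph r v.
have eF := freeact_peval f; have eG := freeact_peval g.
elim=> {p} [v|v|v|v|u v _ IHu _ IHv w|a u _ IH v|u a _ IH v].
- move: (horner_alg Hf f) Hf Xf eF eH eX => P H X eF eH eX.
  by rewrite freeactBl !freeactM eF eH !eX hrep_hx subrr.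
- move: (horner_alg Hf f) Hf Yf eF eH eY => P H Y eF eH eY.
  by rewrite freeactBl !freeactM eF eH !eY hrep_yh subrr.
- move: (horner_alg Hf g) Xf Yf eG eX eY => P X Y eG eX eY.
  by rewrite !freeactBl freeactZl !freeactM eG !eX !eY hrep_yx subrr.
- exact: freeact0l.
- by rewrite freeactDl IHu IHv addr0.
- by rewrite freeactM IH linear0.
- by rewrite freeactM IH.
Qed.

End Act.

End FreeAlg.

Arguments freeact {F q f g} r p v.

Section Shift.
Variables (F : fieldType) (K : choiceType).
Implicit Types (c d : K -> F) (s t : K -> K) (p : {malg F[K]}).

(* The linear map sending the basis vector << k >> to c k *: << s k >>. *)
Definition wshift c s p : {malg F[K]} :=
  \sum_(k <- msupp p) << c k * p@_k *g s k >>.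

Lemma wshiftEw c s (d : {fset K}) p : (msupp p `<=` d)%fset ->
  wshift c s p = \sum_(k <- d) << c k * p@_k *g s k >>.
Proof.
move=> le; rewrite /wshift (big_fset_incl _ le) //= => k _ /mcoeff_outdom ->.
by rewrite mulr0 monalgU0.
Qed.

Lemma malgUZ (a b : F) (k : K) : a *: << b *g k >> = << a * b *g k >>.
Proof. by apply/malgP=> j; rewrite mcoeffZ !mcoeffU mulrnAr. Qed.

Fact wshift_linear c s : linear (wshift c s).
Proof.
move=> a u v; have [leu lev] : (msupp (a *: u) `<=` msupp u `|` msupp v)%fset
  /\ (msupp (a *: u + v) `<=` msupp u `|` msupp v)%fset.
  split; first exact: fsubset_trans (msuppZ_le _ _) (fsubsetUl _ _).
  exact: fsubset_trans (msuppD_le _ _) (fsetSU _ (msuppZ_le _ _)).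
rewrite (wshiftEw _ _ lev) (wshiftEw _ _ (fsubsetUl (msupp u) (msupp v))).
rewrite (wshiftEw _ _ (fsubsetUr (msupp u) (msupp v))) scaler_sumr -big_split.
apply: eq_bigr => k _ /=.
by rewrite mcoeffD mcoeffZ malgUZ -monalgUD mulrDr mulrCA.
Qed.
HB.instance Definition _ c s := GRing.isLinear.Build F {malg F[K]} {malg F[K]} _
  (wshift c s) (wshift_linear c s).

Lemma wshiftU c s a k : wshift c s << a *g k >> = << c k * a *g s k >>.
Proof. by rewrite (wshiftEw c s msuppU_le) big_seq_fset1 mcoeffUU. Qed.

Lemma wshift_comp c s d t p :
  wshift c s (wshift d t p) = wshift (fun k => c (t k) * d k) (s \o t) p.
Proof.
rewrite [in LHS](wshiftEw d t (fsubset_refl _)) linear_sum; apply: eq_bigr=> k _.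
by rewrite /= wshiftU mulrA.
Qed.

Lemma wshiftZ a c s p : a *: wshift c s p = wshift (fun k => a * c k) s p.
Proof.
by rewrite scaler_sumr; apply: eq_bigr => k _; rewrite malgUZ mulrA.
Qed.

Lemma wshiftD c d s p :
  wshift c s p + wshift d s p = wshift (fun k => c k + d k) s p.
Proof.
by rewrite -big_split; apply: eq_bigr => k _ /=; rewrite -monalgUD mulrDl.
Qed.

Lemma wshift1 p : wshift (fun=> 1) id p = p.
Proof. by rewrite [RHS]monalgE; apply: eq_bigr => k _; rewrite mul1r. Qed.

Lemma wshift0 s p : wshift (fun=> 0) s p = 0.
Proof. by rewrite /wshift big1 // => k _; rewrite mul0r monalgU0. Qed.

Lemma eq_wshift c s d t p : c =1 d -> (forall k, c k != 0 -> s k = t k) ->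
  wshift c s p = wshift d t p.
Proof.
move=> ecd est; apply: eq_bigr => k _; rewrite -ecd.
by have [->|/est->//] := eqVneq (c k) 0; rewrite mul0r !monalgU0.
Qed.

Lemma peval_wshift (f : {poly F}) c p :
  peval f (wshift c id) p = wshift (fun k => f.[c k]) id p.
Proof.
transitivity (\sum_(i < size f) wshift (fun k => f`_i * c k ^+ i) id p).
  apply: eq_bigr => i _; rewrite -wshiftZ; congr (_ *: _).
  elim: (i : nat) => [|j IH] /=; first by rewrite wshift1.
  by rewrite IH wshift_comp; apply: eq_wshift => // k /=; rewrite exprS.
rewrite exchange_big; apply: eq_bigr => k _ /=.
by rewrite -[LHS](raddf_sum (mkmalgU k)) -mulr_suml horner_coef.
Qed.

Variables (q : F) (f g : {poly F}) (cx cy ch : K -> F) (sx sy : K -> K).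
Hypothesis hx : forall k, cx k != 0 -> ch (sx k) = f.[ch k].
Hypothesis yh : forall k, cy k != 0 -> ch k = f.[ch (sy k)].
Hypothesis sxK : forall k, sy (sx k) = k.
Hypothesis syK : forall k, cx (sy k) * cy k != 0 -> sx (sy k) = k.
Hypothesis yx : forall k, cy (sx k) * cx k - q * (cx (sy k) * cy k) = g.[ch k].

Fact shift_hx p : wshift ch id (wshift cx sx p) =
  wshift cx sx (peval f (wshift ch id) p).
Proof.
rewrite peval_wshift !wshift_comp; apply: eq_wshift => // k /=.
by rewrite mulrC; have [->|/hx->//] := eqVneq (cx k) 0; rewrite !mul0r.
Qed.

Fact shift_yh p : wshift cy sy (wshift ch id p) =
  peval f (wshift ch id) (wshift cy sy p).
Proof.
rewrite peval_wshift !wshift_comp; apply: eq_wshift => // k /=.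
by rewrite mulrC; have [->|/yh->//] := eqVneq (cy k) 0; rewrite !mulr0.
Qed.

Fact shift_yx p : wshift cy sy (wshift cx sx p) -
    q *: wshift cx sx (wshift cy sy p) = peval g (wshift ch id) p.
Proof.
rewrite peval_wshift !wshift_comp.
rewrite (@eq_wshift (fun k => cx (sy k) * cy k) (sx \o sy) _ id _ (frefl _) syK).
rewrite (@eq_wshift _ (sy \o sx) _ id _ (frefl _)) => [|k _]; last exact: sxK.
rewrite -scaleNr wshiftZ wshiftD; apply: eq_wshift => // k.
by rewrite mulNr yx.
Qed.

Definition shift_rep : hrep q f g := HRep shift_hx shift_yh shift_yx.

End Shift.

Section Alg.
Variables (F : fieldType) (q : F) (f g : {poly F}).
Implicit Types (u v : freealg3 F).

(* H_q(f,g) is nontrivial: it acts on the space with basis (v_i)_(i >= 0)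
   by h v_i = a_i v_i, x v_i = v_(i+1), y v_i = m_i v_(i-1), where a_0 = m_0 = 0. *)
Fixpoint verma_a (i : nat) : F := if i is j.+1 then f.[verma_a j] else 0.
Fixpoint verma_m (i : nat) : F :=
  if i is j.+1 then q * verma_m j + g.[verma_a j] else 0.

Definition verma_rep : hrep q f g.
Proof.
apply: (@shift_rep F nat q f g (fun=> 1) verma_m verma_a succn predn) => //=.
- by case=> [|k] //=; rewrite eqxx.
- by case=> [|k] //=; rewrite mul1r eqxx.
- by move=> k; rewrite mulr1 mul1r addrC addKr.
Defined.

Lemma relideal1 : 1 \notin relideal_pred q f g.
Proof.
apply/negP => /relidealP /(@freeact_relideal _ _ _ _ verma_rep).
move=> /(_ (<< 0%N >> : {malg F[nat]})); rewrite freeact1 => /eqP.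
by rewrite monalgU_eq0 oner_eq0.
Qed.

Definition Hq := Quotient.quot (relideal_pred q f g).
HB.instance Definition _ := GRing.Zmodule.on Hq.
HB.instance Definition _ := EqQuotient.on Hq.

Definition Hpi (u : freealg3 F) : Hq := \pi_Hq u.

End Alg.

HB.lock Definition Hmul (F : fieldType) (q : F) (f g : {poly F})
  (a b : Hq q f g) : Hq q f g := Hpi q f g (repr a * repr b).
HB.lock Definition Hscale (F : fieldType) (q : F) (f g : {poly F})
  (c : F) (a : Hq q f g) : Hq q f g := Hpi q f g (c *: repr a).

Section Alg.
Variables (F : fieldType) (q : F) (f g : {poly F}).
Implicit Types (u v : freealg3 F).
Local Notation Hq := (Hq q f g).
Local Notation Hpi := (Hpi q f g).
Local Notation Hmul := (@Hmul F q f g).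
Local Notation Hscale := (@Hscale F q f g).

Lemma Hpi_eq u v : (Hpi u == Hpi v) = (u - v \in relideal_pred q f g).
Proof. by rewrite Quotient.idealrBE. Qed.
Lemma HpiD u v : Hpi (u + v) = Hpi u + Hpi v.
Proof. exact: Quotient.pi_add. Qed.
Lemma HreprK a : Hpi (repr a) = a.
Proof. exact: reprK. Qed.

Definition Hone : Hq := Hpi 1.

Lemma HpiM u v : Hmul (Hpi u) (Hpi v) = Hpi (u * v).
Proof.
apply/eqP; rewrite Hmul.unlock Hpi_eq; apply/relidealP.
have Ir w : relideal q f g (repr (Hpi w) - w).
  by apply/relidealP; rewrite -Hpi_eq HreprK.
set u' := repr _; set v' := repr _.
have -> : u' * v' - u * v = (u' - u) * v' + u * (v' - v).
  by rewrite mulrBl mulrBr addrA subrK.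
by apply: relidealD; [apply: relidealMr | apply: relidealMl]; apply: Ir.
Qed.

Lemma HpiZ c u : Hscale c (Hpi u) = Hpi (c *: u).
Proof.
apply/eqP; rewrite Hscale.unlock Hpi_eq -scalerBr -mulr_algl; apply/relidealP/relidealMl.
by apply/relidealP; rewrite -Hpi_eq HreprK.
Qed.

Fact HmulA : associative Hmul.
Proof.
by move=> a b c; rewrite -[a]HreprK -[b]HreprK -[c]HreprK !HpiM mulrA.
Qed.
Fact Hmul1r : left_id Hone Hmul.
Proof. by move=> a; rewrite -[a]HreprK HpiM mul1r. Qed.
Fact Hmulr1 : right_id Hone Hmul.
Proof. by move=> a; rewrite -[a]HreprK HpiM mulr1. Qed.
Fact HmulDl : left_distributive Hmul +%R.
Proof.
move=> a b c; rewrite -[a]HreprK -[b]HreprK -[c]HreprK.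
by rewrite -HpiD !HpiM mulrDl HpiD.
Qed.
Fact HmulDr : right_distributive Hmul +%R.
Proof.
move=> a b c; rewrite -[a]HreprK -[b]HreprK -[c]HreprK.
by rewrite -HpiD !HpiM mulrDr HpiD.
Qed.
Fact Hone_neq0 : Hone != 0.
Proof.
have -> : 0 = Hpi 0 by apply: (addrI (Hpi 0)); rewrite -HpiD !addr0.
by rewrite Hpi_eq subr0 relideal1.
Qed.
HB.instance Definition _ := GRing.Zmodule_isNzRing.Build Hq
  HmulA Hmul1r Hmulr1 HmulDl HmulDr Hone_neq0.

Fact HscalerA a b (u : Hq) : Hscale a (Hscale b u) = Hscale (a * b) u.
Proof. by rewrite -[u]HreprK !HpiZ scalerA. Qed.
Fact Hscale1r : left_id 1 Hscale.
Proof. by move=> u; rewrite -[u]HreprK HpiZ scale1r. Qed.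
Fact HscalerDr : right_distributive Hscale +%R.
Proof.
move=> a u v; rewrite -[u]HreprK -[v]HreprK.
by rewrite -HpiD !HpiZ scalerDr HpiD.
Qed.
Fact HscalerDl (u : Hq) : {morph Hscale^~ u : a b / a + b}.
Proof. by move=> a b; rewrite -[u]HreprK !HpiZ scalerDl HpiD. Qed.
HB.instance Definition _ := GRing.Zmodule_isLmodule.Build F Hq
  HscalerA Hscale1r HscalerDr HscalerDl.

Lemma HpiMr u v : Hpi u * Hpi v = Hpi (u * v).
Proof. exact: HpiM. Qed.
Lemma HpiZr c u : c *: Hpi u = Hpi (c *: u).
Proof. exact: HpiZ. Qed.

Fact HscalerAl (c : F) (a b : Hq) : c *: (a * b) = c *: a * b.
Proof.
rewrite -[a]HreprK -[b]HreprK; move: (repr a) (repr b) => u v.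
by rewrite (HpiMr u v) (HpiZr c (u * v)) (HpiZr c u) (HpiMr (c *: u)) scalerAl.
Qed.
HB.instance Definition _ := GRing.Lmodule_isLalgebra.Build F Hq HscalerAl.

Fact HscalerAr (c : F) (a b : Hq) : c *: (a * b) = a * (c *: b).
Proof.
rewrite -[a]HreprK -[b]HreprK; move: (repr a) (repr b) => u v.
by rewrite (HpiMr u v) (HpiZr c (u * v)) (HpiZr c v) (HpiMr u) scalerAr.
Qed.
HB.instance Definition _ := GRing.Lalgebra_isAlgebra.Build F Hq HscalerAr.

Fact Hpi_linear : linear Hpi.
Proof. by move=> a u v; rewrite HpiD -HpiZ. Qed.
HB.instance Definition _ := GRing.isLinear.Build F (freealg3 F) Hq _ Hpi Hpi_linear.
Fact Hpi_monoid : monoid_morphism Hpi.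
Proof. by split=> [|u v]; [|rewrite HpiMr]. Qed.
HB.instance Definition _ :=
  GRing.isMonoidMorphism.Build (freealg3 F) Hq Hpi Hpi_monoid.

Definition Hx : Hq := Hpi (Xf F).
Definition Hy : Hq := Hpi (Yf F).
Definition Hh : Hq := Hpi (Hf F).

Lemma Hpi_horner_alg p : Hpi (horner_alg (Hf F) p) = horner_alg Hh p.
Proof.
rewrite -[p]coefK poly_def !linear_sum /=; apply: eq_bigr => i _.
by rewrite !linearZ /= !mulr_algl linearZ !rmorphXn /= !horner_algX.
Qed.

Lemma Hq_rel r : relideal q f g r -> Hpi r = 0.
Proof.
move=> Ir; apply/eqP; rewrite -[0](linear0 Hpi) Hpi_eq subr0.
exact/relidealP.
Qed.

Lemma Hq_hx : Hh * Hx = Hx * horner_alg Hh f.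
Proof.
apply/eqP; rewrite -subr_eq0 -Hpi_horner_alg -!rmorphM -linearB; apply/eqP.
exact/Hq_rel/relideal_hx.
Qed.
Lemma Hq_yh : Hy * Hh = horner_alg Hh f * Hy.
Proof.
apply/eqP; rewrite -subr_eq0 -Hpi_horner_alg -!rmorphM -linearB; apply/eqP.
exact/Hq_rel/relideal_yh.
Qed.
Lemma Hq_yx : Hy * Hx - q *: (Hx * Hy) = horner_alg Hh g.
Proof.
apply/eqP; rewrite -subr_eq0 -Hpi_horner_alg -!rmorphM -linearZ -!linearB.
exact/eqP/Hq_rel/relideal_yx.
Qed.

End Alg.

(* A copy of the representation space whose scalars are H_q(f,g) and not F. *)
Definition hmod (F : fieldType) (q : F) (f g : {poly F}) (r : hrep q f g) : Type :=
  hspace r.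

HB.lock Definition hact (F : fieldType) (q : F) (f g : {poly F}) (r : hrep q f g)
  (a : Hq q f g) (v : hmod r) : hmod r := freeact r (repr a) v.

Section Hmod.
Variables (F : fieldType) (q : F) (f g : {poly F}) (r : hrep q f g).
Local Notation Hq := (Hq q f g).
Local Notation Hpi := (Hpi q f g).
Local Notation Hx := (Hx q f g).
Local Notation Hy := (Hy q f g).
Local Notation Hh := (Hh q f g).
Local Notation hact := (@hact F q f g r).

HB.instance Definition _ := GRing.Zmodule.on (hmod r).

Lemma hactE u v : hact (Hpi u) v = freeact r u v.
Proof.
apply/eqP; rewrite hact.unlock -subr_eq0 -[_ - _]freeactBl; apply/eqP.
by apply: freeact_relideal; apply/relidealP; rewrite -Hpi_eq HreprK.
Qed.

Fact hactA a b v : hact a (hact b v) = hact (a * b) v.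
Proof.
by rewrite -[a]HreprK -[b]HreprK [Hpi _ * _]HpiM !hactE [RHS]freeactM.
Qed.
Fact hact1 : left_id 1 hact.
Proof. by move=> v; rewrite hactE [LHS]freeact1. Qed.
Fact hactDr : right_distributive hact +%R.
Proof. by move=> a u v; rewrite hact.unlock; apply: (linearD (freeact r (repr a))). Qed.
Fact hactDl v : {morph hact^~ v : a b / a + b}.
Proof.
move=> a b; rewrite -[a]HreprK -[b]HreprK -HpiD !hactE.
exact: freeactDl.
Qed.
HB.instance Definition _ := GRing.Zmodule_isLmodule.Build Hq (hmod r)
  hactA hact1 hactDr hactDl.

Lemma hmod_x (v : hmod r) : Hx *: v = opx r v.
Proof. by rewrite [LHS]hactE freeact_letter. Qed.
Lemma hmod_y (v : hmod r) : Hy *: v = opy r v.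
Proof. by rewrite [LHS]hactE freeact_letter. Qed.
Lemma hmod_h (v : hmod r) : Hh *: v = oph r v.
Proof. by rewrite [LHS]hactE freeact_letter. Qed.
Lemma hmod_scalar (c : F) (v : hmod r) : c%:A *: v = (c *: (v : hspace r)).
Proof.
by rewrite [c%:A]HpiZ [LHS]hactE freeactZl freeact1.
Qed.

Lemma hmod_subsemimod_closed (S : {pred hspace r}) :
    subsemimod_closed S -> {homo opx r : v / v \in S} ->
    {homo opy r : v / v \in S} -> {homo oph r : v / v \in S} ->
  subsemimod_closed (S : {pred hmod r}).
Proof.
move=> [[S0 SD] SZ] Sx Sy Sh; split=> // a v Sv.
rewrite -[a]HreprK [_ *: v]hactE.
apply: (big_ind (fun u => u \in S)) => // w _; apply: SZ.
elim: (w : seq _) => //= i s IH.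
by rewrite /opl; case: (val i) => [|[|n]]; [apply: Sx | apply: Sy | apply: Sh].
Qed.

End Hmod.

(* Finitely supported functions int -> F; the basis vector << i >> is t^i. *)
Definition laurent (F : fieldType) := {malg F[int]}.

HB.lock Definition lmul (F : fieldType) (p r : {malg F[int]}) : {malg F[int]} :=
  \sum_(i <- msupp p) \sum_(j <- msupp r) << p@_i * r@_j *g i + j >>.

Section Laurent.
Variable F : fieldType.
Implicit Types (p r s : laurent F).

HB.instance Definition _ := GRing.Lmodule.on (laurent F).

Definition tpow (i : int) : laurent F := << i >>.

Local Notation lmul := (@lmul F).

Fact lmulE p r : lmul p r = \sum_(i <- msupp p) p@_i *: wshift (fun=> 1) (+%R i) r.
Proof.
rewrite lmul.unlock; apply: eq_bigr => i _; rewrite scaler_sumr.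
by apply: eq_bigr => j _; rewrite malgUZ mul1r.
Qed.

Fact lmulC : commutative lmul.
Proof.
move=> p r; rewrite !lmul.unlock exchange_big; apply: eq_bigr => i _.
by apply: eq_bigr => j _; rewrite mulrC addrC.
Qed.

Fact lmulDr : right_distributive lmul +%R.
Proof.
move=> p r s; rewrite !lmulE -big_split; apply: eq_bigr => i _ /=.
by rewrite linearD scalerDr.
Qed.
Fact lmulDl : left_distributive lmul +%R.
Proof. by move=> p r s; rewrite !(lmulC _ s) lmulDr. Qed.

Fact lmulZr (c : F) p r : lmul p (c *: r) = c *: lmul p r.
Proof.
rewrite !lmulE scaler_sumr; apply: eq_bigr => i _.
by rewrite linearZ /= !scalerA mulrC.
Qed.
Fact lmulZl (c : F) p r : c *: lmul p r = lmul (c *: p) r.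
Proof. by rewrite ![lmul _ r]lmulC lmulZr. Qed.

Fact lmulUU (a b : F) (i j : int) :
  lmul << a *g i >> << b *g j >> = << a * b *g i + j >>.
Proof.
rewrite lmulE (big_fset_incl _ (@msuppU_le _ _ i a)) => [|k _ /mcoeff_outdom ->];
  last by rewrite scale0r.
by rewrite big_seq_fset1 mcoeffUU wshiftU malgUZ mul1r.
Qed.

Fact lmul0r p : lmul 0 p = 0.
Proof. by rewrite lmulE msupp0 big_seq_fset0. Qed.

Fact lmulr0 p : lmul p 0 = 0.
Proof. by rewrite lmulC lmul0r. Qed.

Fact laurent_ind (P : laurent F -> Prop) :
  P 0 -> (forall p r, P p -> P r -> P (p + r)) ->
  (forall (a : F) (i : int), P << a *g i >>) -> forall p, P p.
Proof.
by move=> P0 PD PU p; rewrite [p]monalgE; elim/big_ind: _.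
Qed.

Fact lmulA : associative lmul.
Proof.
move=> p r s; elim/laurent_ind: p => [|p1 p2 IH1 IH2|a i]; first by rewrite !lmul0r.
  by rewrite !lmulDl IH1 IH2.
elim/laurent_ind: r => [|r1 r2 IH1 IH2|b j].
- by rewrite lmul0r !lmulr0 lmul0r.
- by rewrite lmulDl !lmulDr IH1 IH2 lmulDl.
elim/laurent_ind: s => [|s1 s2 IH1 IH2|c k].
- by rewrite !lmulr0.
- by rewrite !lmulDr IH1 IH2.
by rewrite !lmulUU mulrA addrA.
Qed.

Fact lmul1r : left_id (tpow 0) lmul.
Proof.
elim/laurent_ind => [|p1 p2 IH1 IH2|a i]; first by rewrite lmulr0.
  by rewrite lmulDr IH1 IH2.
by rewrite lmulUU mul1r add0r.
Qed.

Fact tpow0_neq0 : tpow 0 != 0.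
Proof. by rewrite monalgU_eq0 oner_eq0. Qed.

HB.instance Definition _ := GRing.Zmodule_isComNzRing.Build (laurent F)
  lmulA lmulC lmul1r lmulDl tpow0_neq0.
HB.instance Definition _ := GRing.Lmodule_isLalgebra.Build F (laurent F) lmulZl.
HB.instance Definition _ := GRing.Lalgebra_isComAlgebra.Build F (laurent F).

Lemma tpowD i j : tpow (i + j) = tpow i * tpow j.
Proof. by rewrite [RHS]lmulUU mul1r. Qed.

Definition laurent_ideal (n : nat) (gamma : F) : {pred laurent F} :=
  fun p => `[< exists r, p = r * (tpow n - gamma%:A) >].

Lemma laurent_idealP (n : nat) gamma p :
  reflect (exists r, p = r * (tpow n - gamma%:A)) (p \in laurent_ideal n gamma).
Proof. exact: asboolP. Qed.

Lemma laurent_ideal_subsemimod (n : nat) gamma :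
  subsemimod_closed (laurent_ideal n gamma).
Proof.
split; first split.
- by apply/laurent_idealP; exists 0; rewrite mul0r.
- move=> _ _ /laurent_idealP[r ->] /laurent_idealP[s ->].
  by apply/laurent_idealP; exists (r + s); rewrite mulrDl.
- move=> c _ /laurent_idealP[r ->].
  by apply/laurent_idealP; exists (c *: r); rewrite scalerAl.
Qed.

Lemma mul_tpow p i : p * tpow i = wshift (fun=> 1) (+%R i) p.
Proof.
rewrite mulrC [LHS]lmulE msuppU oner_eq0 big_seq_fset1 mcoeffUU.
by rewrite scale1r.
Qed.

Lemma laurent_ideal_wshift (n : nat) gamma (c : int -> F) (s : int -> int) :
    (forall k, c (k + n%:Z) = c k) -> (forall k, s (k + n%:Z) = s k + n%:Z) ->
  {homo wshift c s : p / p \in laurent_ideal n gamma}.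
Proof.
move=> cn sn _ /laurent_idealP[r ->]; apply/laurent_idealP.
have E : wshift c s (wshift (fun=> 1) (+%R n%:Z) r)
    = wshift (fun=> 1) (+%R n%:Z) (wshift c s r).
  rewrite !wshift_comp; apply: eq_wshift => [k|k _] /=.
    by rewrite mulr1 mul1r addrC cn.
  by rewrite addrC sn addrC.
exists (wshift c s r); rewrite !mulrBr !mulr_algr !mul_tpow.
by rewrite linearB linearZ /= E.
Qed.

End Laurent.

(* The nonnegative generator of a subgroup G of int; nngenP justifies it. *)
Definition nngen (G : int -> Prop) : nat :=
  xget 0%N [set n | forall k : int, G k <-> (n%:Z %| k)%Z]%classic.

Lemma nngenP (G : int -> Prop) : G 0 -> (forall a b, G a -> G b -> G (a - b)) ->
  forall k : int, G k <-> ((nngen G)%:Z %| k)%Z.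
Proof.
move=> G0 GB.
have GN a : G a -> G (- a) by move=> Ga; rewrite -sub0r; apply: GB.
have GD a b : G a -> G b -> G (a + b).
  by move=> Ga Gb; rewrite -[b]opprK; apply: GB => //; apply: GN.
have GMn a m : G a -> G (a *+ m).
  by move=> Ga; elim: m => [|m IH]; rewrite ?mulr0n // mulrS; apply: GD.
have GM a z : G a -> G (z * a).
  move=> Ga; have GP (m : nat) : G (m%:Z * a).
    by rewrite -natz mulr_natl; apply: GMn.
  by case: z => m //; rewrite NegzE mulNr; apply: GN.
suff [n Gn] : exists n : nat, forall k : int, G k <-> (n%:Z %| k)%Z.
  rewrite /nngen.
  by case: xgetP => [m _ //|/(_ n)] /=.
have [[n0 /andP[n0_gt0 Gn0]]|noG] :=
    pselect (exists n : nat, (0 < n)%N && `[< G n%:Z >]).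
  have ex : exists n : nat, (0 < n)%N && `[< G n%:Z >].
    by exists n0; rewrite n0_gt0.
  case: (ex_minnP ex) => n /andP[n_gt0 /asboolP Gn] n_min.
  exists n => k; split=> [Gk|/dvdzP[z ->]]; last exact: GM.
  have n_neq0 : n%:Z != 0 by rewrite -lt0n in n_gt0 *; case: (n) n_gt0.
  have Gr : G (k %% n%:Z)%Z.
    rewrite -[X in G X](addKr ((k %/ n%:Z)%Z * n%:Z)) -divz_eq addrC.
    by apply: GB => //; apply: GM.
  apply/dvdz_mod0P/eqP; apply: contraPT Gr => r_neq0 Gr.
  have r_ge0 := modz_ge0 k n_neq0.
  have r_lt := ltz_pmod k (n_gt0 : 0 < n%:Z).
  case: (k %% n%:Z)%Z r_neq0 Gr r_ge0 r_lt => // m m_neq0 Gm _.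
  rewrite ltz_nat ltnNge n_min //; apply/andP; split; last exact/asboolP.
  by rewrite lt0n.
exists 0%N => k; rewrite dvd0z; split=> [Gk|/eqP-> //].
apply/negPn/negP => k_neq0; apply: noG; exists `|k|%N.
rewrite absz_gt0 k_neq0; apply/asboolP.
by rewrite abszE; case: (normrEsign k) => ->; rewrite ?GM //; case: (_ < _); apply/GM.
Qed.

Section Sequences.
Variable F : fieldType.

(* Sf, Tqg, period, tperiod: S_f, T_{q,g,lambda}, |lambda| and |mu|. *)
Record Sf (f : {poly F}) := MkSf {
  sf_fun :> int -> F;
  sfP : forall i, f.[sf_fun i] = sf_fun (i + 1) }.

Record Tqg (q : F) (f g : {poly F}) (l : Sf f) := MkTqg {
  tqg_fun :> int -> F;
  tqgP : forall i, tqg_fun (i + 1) = q * tqg_fun i + g.[l i] }.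

Definition period (f : {poly F}) (l : Sf f) : nat :=
  nngen (fun k => forall i, l i = l (i + k)).

Definition tperiod (q : F) (f g : {poly F}) (l : Sf f) (m : Tqg q g l) : nat :=
  nngen (fun k => m (k * (period l)%:Z) = m 0).

Variables (q : F) (f g : {poly F}) (l : Sf f) (m : Tqg q g l).

Lemma periodP (k : int) :
  (forall i, l i = l (i + k)) <-> ((period l)%:Z %| k)%Z.
Proof.
apply: (nngenP (G := fun k => forall i, l i = l (i + k))) => [i|a b Ha Hb i].
  by rewrite addr0.
by rewrite (Hb (i + (a - b))) -addrA subrK -Ha.
Qed.

Hypothesis q_neq0 : q != 0.

Lemma tqg_shift (a b : int) : (forall k, l (a + k) = l (b + k)) ->
  m a = m b -> forall k, m (a + k) = m (b + k).
Proof.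
move=> lab mab; elim/int_ind => [|n IH|n IH]; first by rewrite !addr0.
  by rewrite -addn1 PoszD !addrA !tqgP IH lab.
apply: (mulfI q_neq0); apply: (addIr g.[l (a - n.+1%:Z)]).
rewrite {2}lab -!tqgP -addn1 PoszD opprD !addrA !subrK.
exact: IH.
Qed.

Lemma tperiodP (k : int) :
  m (k * (period l)%:Z) = m 0 <-> ((tperiod m)%:Z %| k)%Z.
Proof.
have per (z : int) i : l (z * (period l)%:Z + i) = l (0 + i).
  have /periodP per : ((period l)%:Z %| z * (period l)%:Z)%Z by rewrite dvdz_mull.
  by rewrite addrC add0r -per.
apply: (nngenP (G := fun k => m (k * (period l)%:Z) = m 0)) => [|a b Ha Hb].
  by rewrite mul0r.
have := tqg_shift (per b) Hb ((a - b) * (period l)%:Z).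
by rewrite -mulrDl addrC subrK add0r Ha => ->.
Qed.

Definition totperiod : nat := (period l * tperiod m)%N.

Lemma sf_totperiod (i : int) : l (i + totperiod%:Z) = l i.
Proof.
have /periodP per : ((period l)%:Z %| totperiod%:Z)%Z by rewrite PoszM dvdz_mulr.
by rewrite -per.
Qed.

Lemma tqg_totperiod (i : int) : m (i + totperiod%:Z) = m i.
Proof.
have e : m totperiod%:Z = m 0.
  by rewrite PoszM mulrC; apply/tperiodP.
rewrite addrC -[in RHS](add0r i); apply: tqg_shift => // k.
by rewrite addrC sf_totperiod add0r.
Qed.

End Sequences.

Section Modules.
Variables (F : fieldType) (q : F) (f g : {poly F}).
Variables (l : Sf f) (m : Tqg q g l).

(* h t^i = l(i) t^i,  x t^i = t^(i+1),  y t^i = m(i) t^(i-1) *)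
Definition Arep : hrep q f g.
Proof.
apply: (@shift_rep F int q f g (fun=> 1) m l (+%R 1) (+%R (-1))) => [k _|k _|k|k _|k].
- by rewrite sfP addrC.
- by rewrite sfP addrC addNKr.
- by rewrite addKr.
- by rewrite addNKr.
- by rewrite mulr1 mul1r [1 + k]addrC tqgP addrC addKr.
Defined.

(* h t^i = l(i) t^i,  x t^i = m(i+1) t^(i+1),  y t^i = t^(i-1) *)
Definition Brep : hrep q f g.
Proof.
apply: (@shift_rep F int q f g (fun k => m (k + 1)) (fun=> 1) l (+%R 1) (+%R (-1)))
  => [k _|k _|k|k _|k].
- by rewrite sfP addrC.
- by rewrite sfP addrC addNKr.
- by rewrite addKr.
- by rewrite addNKr.
- by rewrite mulr1 mul1r [-1 + k]addrC subrK tqgP addrC addKr.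
Defined.

Definition Amod := hmod Arep.
Definition Bmod := hmod Brep.
HB.instance Definition _ := GRing.Lmodule.on Amod.
HB.instance Definition _ := GRing.Lmodule.on Bmod.

Definition Avec (p : laurent F) : Amod := p.
Definition Bvec (p : laurent F) : Bmod := p.

Lemma Amod_h i : Hh q f g *: Avec (tpow F i) = Avec (l i *: tpow F i).
Proof. by rewrite [LHS]hmod_h [LHS]wshiftU mulr1 [RHS]malgUZ mulr1. Qed.
Lemma Amod_x i : Hx q f g *: Avec (tpow F i) = Avec (tpow F (i + 1)).
Proof. by rewrite [LHS]hmod_x [LHS]wshiftU mulr1 addrC. Qed.
Lemma Amod_y i : Hy q f g *: Avec (tpow F i) = Avec (m i *: tpow F (i - 1)).
Proof. by rewrite [LHS]hmod_y [LHS]wshiftU mulr1 addrC [RHS]malgUZ mulr1. Qed.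
Lemma Bmod_h i : Hh q f g *: Bvec (tpow F i) = Bvec (l i *: tpow F i).
Proof. by rewrite [LHS]hmod_h [LHS]wshiftU mulr1 [RHS]malgUZ mulr1. Qed.
Lemma Bmod_x i : Hx q f g *: Bvec (tpow F i) = Bvec (m (i + 1) *: tpow F (i + 1)).
Proof. by rewrite [LHS]hmod_x [LHS]wshiftU mulr1 addrC [RHS]malgUZ mulr1. Qed.
Lemma Bmod_y i : Hy q f g *: Bvec (tpow F i) = Bvec (tpow F (i - 1)).
Proof. by rewrite [LHS]hmod_y [LHS]wshiftU mulr1 addrC. Qed.

Variable gamma : F.

Definition Aideal : {pred Amod} := laurent_ideal (period l * tperiod m) gamma.
Definition Bideal : {pred Bmod} := laurent_ideal (period l * tperiod m) gamma.

Hypothesis q_neq0 : q != 0.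

Fact Aideal_closed : subsemimod_closed Aideal.
Proof.
apply: hmod_subsemimod_closed; first exact: laurent_ideal_subsemimod;
  move=> v; apply: laurent_ideal_wshift => // k; rewrite ?addrA //.
- exact: tqg_totperiod.
- exact: sf_totperiod.
Qed.

Fact Bideal_closed : subsemimod_closed Bideal.
Proof.
apply: hmod_subsemimod_closed; first exact: laurent_ideal_subsemimod;
  move=> v; apply: laurent_ideal_wshift => // k; rewrite ?addrA //.
- by rewrite addrAC; apply: tqg_totperiod.
- exact: sf_totperiod.
Qed.

Definition Asub : submodClosed Amod :=
  HB.pack Aideal (GRing.isSubSemiModClosed.Build _ _ Aideal Aideal_closed).
Definition Bsub : submodClosed Bmod :=
  HB.pack Bideal (GRing.isSubSemiModClosed.Build _ _ Bideal Bideal_closed).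

End Modules.

Definition lmod_iso (R : pzRingType) (M N : lmodType R) : Prop :=
  exists phi : {linear M -> N}, bijective phi.

(* Main.v *)
Require Import Defs.
From HB Require Import structures.
From mathcomp Require Import all_boot all_order all_algebra.
From mathcomp Require Import finmap monalg.
From mathcomp Require Import ring zify.

(** Write N = |lambda||mu|.  In both families of modules the class e_i of t^i is a
    common eigenvector of h and of xy, with eigenvalues lambda(i) and mu(i); the
    sequence (lambda, mu) is N-periodic and each of its terms determines the next.

    Let phi be an isomorphism.  Then phi(e_0) is a nonzero common eigenvector of
    h and xy in the quotient of B, with eigenvalues lambda(0) and mu(0).  The e_i
    span that quotient, so some r has lambda'(r) = lambda(0) and mu'(r) = mu(0)
    ([joint_eigen]).  The two sequences then agree up to the shift by r
    ([orbit_eq]): forwards by the recursions, backwards by periodicity.  Hence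
    they have the same period N ([totperiod_shift]), and x^N acts as the scalar
    gamma on the quotient of A and as gamma' mu(0)...mu(N-1) on that of B.
    This gives the relation between gamma and gamma', because phi(e_0) is
    nonzero.  Reducing the shift modulo N and dividing it by |lambda| gives the
    pair (i, j).

    Conversely gamma is nonzero, so the relation makes mu(0), ..., mu(N-1) and
    then all mu(i) nonzero, and there is a nowhere zero sequence c with
    c(i+1) = c(i) mu(i+1) ([cumulative_prod]).  If lambda'(k) = lambda(k+s) and
    mu'(k) = mu(k+s), then the map t^i |-> c(i) t^(i-s) is an isomorphism from A
    to B.  Since c(i+N) = c(i) mu(0)...mu(N-1), it sends t^i (t^N - gamma) to a
    multiple of t^(i-s) (t^N - gamma'), and its inverse does the reverse
    ([laurent_ideal_wshift_scaled]), so it descends to the quotients. *)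

Import GRing.Theory.
Local Open Scope ring_scope.

Set Implicit Arguments.
Unset Strict Implicit.

(** * Periodic integer-indexed sequences *)

Lemma int_residue (n : nat) : (0 < n)%N ->
  forall i : int, exists (k : 'I_n) (z : int), i = k%:Z + z * n%:Z.
Proof.
move=> n_gt0 i; have n_neq0 : n%:Z != 0 by lia.
have := modz_ge0 i n_neq0; have := ltz_pmod i (n_gt0 : 0 < n%:Z).
rewrite {3}(divz_eq i n%:Z) addrC.
by case: (i %% n%:Z)%Z => // k k_lt _; exists (Ordinal k_lt), (i %/ n%:Z)%Z.
Qed.

Section Periodic.
Variables (T : Type) (u : int -> T) (n : nat).
Hypothesis un : forall i, u (i + n%:Z) = u i.

Lemma periodic_mul (z i : int) : u (i + z * n%:Z) = u i.
Proof.
elim/int_ind: z i => [|z IH|z IH] i; first by rewrite mul0r addr0.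
  by rewrite -[RHS]IH -[RHS]un; congr u; lia.
by rewrite -[RHS]IH -[LHS]un; congr u; lia.
Qed.

End Periodic.

(** A negative index is moved to a natural one by a multiple of the common
    period. *)
Lemma periodic_eq (T : Type) (u v : int -> T) (n : nat) : (0 < n)%N ->
    (forall i, u (i + n%:Z) = u i) -> (forall i, v (i + n%:Z) = v i) ->
  (forall k : nat, u k%:Z = v k%:Z) -> u =1 v.
Proof.
move=> n_gt0 un vn uv [k|k]; first exact: uv.
rewrite -(periodic_mul un k.+1%:Z) -(periodic_mul vn k.+1%:Z).
have -> : Negz k + k.+1%:Z * n%:Z = (k.+1 * n.-1)%N%:Z by nia.
exact: uv.
Qed.

(** Moving the window by one step trades its first factor for an equal last one;
    no factor has to be cancelled, so zeros of u are harmless. *)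
Lemma prod_period (F : fieldType) (u : int -> F) (n : nat) :
    (forall i, u (i + n%:Z) = u i) ->
  forall a, \prod_(j < n) u (a + j%:Z) = \prod_(j < n) u j%:Z.
Proof.
move=> un a.
have S b : \prod_(j < n) u (b + 1 + j%:Z) = \prod_(j < n) u (b + j%:Z).
  case: n un => [|k] un; first by rewrite !big_ord0.
  rewrite big_ord_recr [RHS]big_ord_recl /= mulrC addr0; congr (_ * _).
    by rewrite -(un b); congr u; lia.
  by apply: eq_bigr => j _; congr u; rewrite /bump /=; lia.
have -> : \prod_(j < n) u j%:Z = \prod_(j < n) u (0 + j%:Z).
  by apply: eq_bigr => j _; rewrite add0r.
elim/int_ind: a => // k <-; rewrite -S; last first.
  by rewrite -addn1 PoszD opprD subrK.
by rewrite S -addn1 PoszD S.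
Qed.

Lemma cumulative_prod (F : fieldType) (u : int -> F) : (forall i, u i != 0) ->
  exists c : int -> F,
    (forall i, c (i + 1) = c i * u (i + 1)) /\ (forall i, c i != 0).
Proof.
move=> u_neq0.
(* c(n) = u(1)...u(n), and c(-n) = 1 / (u(0) u(-1)...u(1-n)). *)
exists (fun i => match i with
  | Posz n => \prod_(j < n) u (j%:Z + 1)
  | Negz n => (\prod_(j < n.+1) u (- j%:Z))^-1 end); split=> [[n|[|n]]|[n|n]].
- rewrite (_ : n%:Z + 1 = n.+1%:Z); last by lia.
  by rewrite big_ord_recr /=; congr (_ * u _); lia.
- by rewrite (_ : Negz 0 + 1 = 0%:Z) // big_ord1 big_ord0 mulVf.
- rewrite (_ : Negz n.+1 + 1 = Negz n); last by lia.
  rewrite [in RHS]big_ord_recr /= invfM -mulrA (_ : - n.+1%:Z = Negz n); last by lia.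
  by rewrite mulVf ?mulr1.
- by apply/prodf_neq0.
by rewrite invr_eq0; apply/prodf_neq0.
Qed.

Lemma cumulative_prodD (F : fieldType) (c u : int -> F) :
    (forall i, c (i + 1) = c i * u (i + 1)) ->
  forall (n : nat) i, c (i + n%:Z) = c i * \prod_(j < n) u (i + 1 + j%:Z).
Proof.
move=> cS; elim=> [|n IH] i; first by rewrite big_ord0 addr0 mulr1.
rewrite big_ord_recr mulrA -IH (_ : i + n.+1%:Z = i + n%:Z + 1); last by lia.
by rewrite cS; congr (_ * u _); rewrite /=; lia.
Qed.

Section Sequences.
Variables (F : fieldType) (q : F) (f g : {poly F}) (q_neq0 : q != 0).

(** The product |lambda||mu| is the exact period of the pair (lambda, mu), and is
    therefore determined by that pair as a function on the integers. *)
Lemma totperiodP (l : Sf f) (m : Tqg q g l) (k : int) :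
  (forall i, l (i + k) = l i) /\ (forall i, m (i + k) = m i)
  <-> ((totperiod m)%:Z %| k)%Z.
Proof.
split=> [[lk mk]|/dvdzP[z ->]]; last first.
  split; apply: periodic_mul; [exact: sf_totperiod | exact: tqg_totperiod].
have /dvdzP[z def_k] : ((period l)%:Z %| k)%Z by apply/periodP.
have : ((tperiod m)%:Z %| z)%Z by apply/tperiodP; rewrite // -def_k -[RHS]mk add0r.
by move=> /dvdzP[z' def_z]; apply/dvdzP; exists z'; rewrite def_k def_z PoszM; ring.
Qed.

Lemma totperiod_shift (l l' : Sf f) (m : Tqg q g l) (m' : Tqg q g l') r :
    (forall k, l' k = l (k + r)) -> (forall k, m' k = m (k + r)) ->
  totperiod m' = totperiod m.
Proof.
move=> l'E m'E; apply/eqP; rewrite eqn_dvd.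
have E k : ((totperiod m')%:Z %| k)%Z <-> ((totperiod m)%:Z %| k)%Z.
  split=> /totperiodP[lk mk]; apply/totperiodP; split=> i.
  - by rewrite -[i](subrK r) addrAC -!l'E lk.
  - by rewrite -[i](subrK r) addrAC -!m'E mk.
  - by rewrite !l'E addrAC lk.
  - by rewrite !m'E addrAC mk.
by apply/andP; split; rewrite -[(_ %| _)%N]/(_%:Z %| _%:Z)%Z; apply/E.
Qed.

(** The polynomial f need not be injective, so a term of lambda does not determine
    the previous one; going backwards uses that both pairs are periodic, a
    common period being the product of their periods. *)
Lemma orbit_eq (l l' : Sf f) (m : Tqg q g l) (m' : Tqg q g l') r :
    (0 < totperiod m)%N -> (0 < totperiod m')%N -> l' r = l 0 -> m' r = m 0 ->
  (forall k, l' k = l (k - r)) /\ (forall k, m' k = m (k - r)).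
Proof.
move=> N_gt0 N'_gt0 lr mr; set n := (totperiod m * totperiod m')%N.
have n_gt0 : (0 < n)%N by rewrite muln_gt0 N_gt0.
have lN (k : nat) : l k%:Z = l' (k%:Z + r) /\ m k%:Z = m' (k%:Z + r).
  elim: k => [|k [IHl IHm]]; first by rewrite add0r.
  by rewrite -addn1 PoszD [_ + 1 + r]addrAC -!sfP !tqgP IHl IHm.
have [[ln mn] [l'n m'n]] :
    ((forall i, l (i + n%:Z) = l i) /\ (forall i, m (i + n%:Z) = m i)) /\
    ((forall i, l' (i + n%:Z) = l' i) /\ (forall i, m' (i + n%:Z) = m' i)).
  by split; apply/totperiodP => //; [apply: dvdn_mulr | apply: dvdn_mull].
split=> k; rewrite -{1}[k](subrK r); apply/esym.
- apply: (@periodic_eq _ l (fun i => l' (i + r)) _ n_gt0 _ _ _ (k - r)) => // [i|i].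
    by rewrite addrAC l'n.
  by case: (lN i).
- apply: (@periodic_eq _ m (fun i => m' (i + r)) _ n_gt0 _ _ _ (k - r)) => // [i|i].
    by rewrite addrAC m'n.
  by case: (lN i).
Qed.

End Sequences.

(** * Weight vectors in modules over an algebra *)

Section Weight.
Variables (F : fieldType) (R : algType F) (M : lmodType R).

(** F acts on M only through the scalars c%:A of R; these are central. *)
Lemma algscaleC (T : R) (c : F) (u : M) : T *: (c%:A *: u) = c%:A *: (T *: u).
Proof. by rewrite !scalerA mulr_algr mulr_algl. Qed.

Lemma algscaleA (a b : F) (u : M) : a%:A *: (b%:A *: u) = (a * b)%:A *: u.
Proof. by rewrite scalerA mulr_algl scalerA. Qed.

Lemma scalar_eigen (T : R) (c : F) (u : M) : T *: u = c%:A *: u ->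
  forall a : F, T *: (a%:A *: u) = c%:A *: (a%:A *: u).
Proof. by move=> Tu a; rewrite algscaleC Tu algscaleC. Qed.

Lemma prod_eigen (I : Type) (s : seq I) (T : I -> R) (c : I -> F) (u : M) :
    (forall i, T i *: u = (c i)%:A *: u) ->
  (\prod_(i <- s) T i) *: u = (\prod_(i <- s) c i)%:A *: u.
Proof.
move=> Tu; elim: s => [|i s IH]; first by rewrite !big_nil !scale1r.
by rewrite !big_cons -scalerA IH (scalar_eigen (Tu i)) algscaleA.
Qed.

Lemma algscale_eq0 (c : F) (u : M) : c%:A *: u = 0 -> u != 0 -> c = 0.
Proof.
move=> cu u_neq0; apply: contraNeq u_neq0 => c_neq0.
by rewrite -[u]scale1r -(scale1r (1 : R)) -(mulVf c_neq0) -algscaleA cu scaler0.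
Qed.

Definition spans (e : int -> M) := forall u : M,
  exists (s : seq int) (a : int -> F), u = \sum_(k <- s) (a k)%:A *: e k.

Lemma spans_eigen (e : int -> M) (T : R) (c : F) : spans e ->
  (forall i, T *: e i = c%:A *: e i) -> forall u : M, T *: u = c%:A *: u.
Proof.
move=> span_e Te u; have [s [a ->]] := span_e u; rewrite !scaler_sumr.
by apply: eq_bigr => i _; apply: scalar_eigen.
Qed.

(** If no index has both eigenvalues (a, b), then for each residue k modulo n one
    of S - m(k), T - l(k) acts on u by a nonzero scalar.  The product of these n
    operators kills every e_i, hence the whole module, but acts on u by a nonzero
    scalar. *)
Lemma joint_eigen (e : int -> M) (T S : R) (l m : int -> F) (n : nat) :
    (0 < n)%N -> (forall i, l (i + n%:Z) = l i) -> (forall i, m (i + n%:Z) = m i) ->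
    spans e -> (forall i, T *: e i = (l i)%:A *: e i) ->
    (forall i, S *: e i = (m i)%:A *: e i) ->
  forall (u : M) (a b : F), u != 0 -> T *: u = a%:A *: u -> S *: u = b%:A *: u ->
  exists r, l r = a /\ m r = b.
Proof.
move=> n_gt0 ln mn span_e Te Se u a b u_neq0 Tu Su.
have [/existsP[r /eqP[<- <-]]|] :=
  boolP [exists r : 'I_n, (l r%:Z, m r%:Z) == (a, b)]; first by exists r%:Z.
rewrite negb_exists => /forallP no_r; exfalso.
pose D (k : 'I_n) := if l k%:Z == a then S - (m k%:Z)%:A else T - (l k%:Z)%:A.
pose d (x y : F) (k : 'I_n) := if l k%:Z == a then y - m k%:Z else x - l k%:Z.
have Dd (v : M) x y : T *: v = x%:A *: v -> S *: v = y%:A *: v ->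
    forall k, D k *: v = (d x y k)%:A *: v.
  by move=> Tv Sv k; rewrite /D /d; case: ifP => _; rewrite !scalerBl ?Tv ?Sv.
have D0 : \prod_k D k *: u = 0%:A *: u.
  apply: (spans_eigen span_e) => i.
  rewrite (prod_eigen _ (Dd _ _ _ (Te i) (Se i))).
  congr (_%:A *: _).
  have [k [z ->]] := int_residue n_gt0 i.
  apply/eqP/prodf_eq0; exists k => //.
  by rewrite /d (periodic_mul ln) (periodic_mul mn) !subrr if_same.
move: D0; rewrite (prod_eigen _ (Dd _ _ _ Tu Su)) !scale0r.
move/algscale_eq0/(_ u_neq0)/eqP/prodf_eq0 => [k _].
move: (no_r k); rewrite xpair_eqE /d; case: ifP => /= [_|/negbT].
  by rewrite subr_eq0 eq_sym => /negP.
by rewrite subr_eq0 eq_sym => /negP.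
Qed.

Lemma weighted_shift_exp (e : int -> M) (x : R) (m : int -> F) :
    (forall i, x *: e i = (m (i + 1))%:A *: e (i + 1)) ->
  forall n i, x ^+ n *: e i = (\prod_(j < n) m (i + 1 + j%:Z))%:A *: e (i + n%:Z).
Proof.
move=> xe; elim=> [|n IH] i; first by rewrite expr0 big_ord0 !scale1r addr0.
rewrite exprSr -scalerA xe algscaleC IH algscaleA.
rewrite big_ord_recl addr0; congr ((_ * _)%:A *: e _); last by lia.
by apply: eq_bigr => j _; congr m; rewrite lift0; lia.
Qed.

End Weight.

(** * Laurent polynomials modulo t^n - gamma *)

Lemma laurent_span (F : fieldType) (p : laurent F) :
  exists (s : seq int) (a : int -> F), p = \sum_(k <- s) a k *: tpow F k.
Proof.
exists (msupp p), (fun k => mcoeff k p); rewrite {1}[p]monalgE.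
by apply: eq_bigr => k _; rewrite /tpow malgUZ mulr1.
Qed.

Lemma wshift_mul_binomial (F : fieldType) (c : int -> F) (s : int -> int) (n : nat)
    (gamma : F) (r : laurent F) :
  wshift c s (r * (tpow F n - gamma%:A)) =
  wshift (fun k => c (k + n%:Z)) (fun k => s (k + n%:Z)) r - gamma *: wshift c s r.
Proof.
rewrite mulrBr mulr_algr mul_tpow.
rewrite [LHS](linearB (wshift c s)) /=; congr (_ - _); last exact: linearZ.
by rewrite wshift_comp; apply: eq_wshift => [k|k _] /=; rewrite ?mulr1 addrC.
Qed.

(** The image of r (t^n - gamma) is P t^n w - gamma w = P w (t^n - gamma'), where
    w is the image of r. *)
Lemma laurent_ideal_wshift_scaled (F : fieldType) (n : nat) (gamma gamma' P : F)
    (c : int -> F) (s : int -> int) : gamma = gamma' * P ->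
    (forall k, c (k + n%:Z) = c k * P) -> (forall k, s (k + n%:Z) = s k + n%:Z) ->
  forall p : laurent F, p \in laurent_ideal n gamma ->
  (wshift c s p : laurent F) \in laurent_ideal n gamma'.
Proof.
move=> def_gamma cn sn _ /laurent_idealP[r ->]; apply/laurent_idealP.
exists (P *: wshift c s r : laurent F).
rewrite wshift_mul_binomial -scalerAl mulrBr mulr_algr mul_tpow scalerBr scalerA.
rewrite [P * _]mulrC -def_gamma; congr (_ - _).
rewrite wshift_comp wshiftZ; apply: eq_wshift => [k|k _] /=; first by rewrite cn mul1r mulrC.
by rewrite sn addrC.
Qed.

(** The linear form sending t^(kn) to gamma^k and the other powers of t to 0
    vanishes on the ideal and is 1 at t^0. *)
Lemma laurent_ideal_tpow0 (F : fieldType) (n : nat) (gamma : F) :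
  (0 < n)%N -> gamma != 0 -> tpow F 0 \notin laurent_ideal n gamma.
Proof.
move=> n_gt0 gamma_neq0; apply/negP => /laurent_idealP[r].
have n_neq0 : n%:Z != 0 by lia.
pose c (k : int) := if (k %% n%:Z)%Z == 0 then gamma ^ (k %/ n%:Z)%Z else 0.
have cn k : c (k + n%:Z) = gamma * c k.
  rewrite /c modzDr divzDr ?dvdzz // divzz n_neq0.
  by case: ifP => _; rewrite ?mulr0 // expfzDr // expr1z mulrC.
(* The linear form, with values in the line spanned by t^0. *)
move/(congr1 (wshift c (fun=> 0 : int))); rewrite wshift_mul_binomial wshiftZ.
rewrite (eq_wshift _ cn (fun _ _ => erefl)).
rewrite subrr wshiftU /c mod0z div0z eqxx expr0z mulr1 => /eqP.
by rewrite monalgU_eq0 oner_eq0.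
Qed.

(** * Modules over H_q(f,g) from representations *)

Lemma quotmod_iso (R : pzRingType) (M N : lmodType R)
    (SM : submodClosed M) (SN : submodClosed N) (phi : {linear M -> N}) (psi : N -> M) :
    cancel phi psi -> cancel psi phi ->
    (forall v, v \in SM -> phi v \in SN) -> (forall v, v \in SN -> psi v \in SM) ->
  lmod_iso (quotmod SM) (quotmod SN).
Proof.
move=> phiK psiK phiS psiS.
have psiB u v : psi (u - v) = psi u - psi v.
  by apply: (can_inj phiK); rewrite linearB !psiK.
pose Phi (u : quotmod SM) : quotmod SN := quotmod_pi SN (phi (repr u)).
pose Psi (u : quotmod SN) : quotmod SM := quotmod_pi SM (psi (repr u)).
have PhiE v : Phi (quotmod_pi SM v) = quotmod_pi SN (phi v).
  by apply/eqP; rewrite quotmod_eq -linearB phiS // -quotmod_eq quotmod_reprK.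
have PsiE v : Psi (quotmod_pi SN v) = quotmod_pi SM (psi v).
  by apply/eqP; rewrite quotmod_eq -psiB psiS // -quotmod_eq quotmod_reprK.
have Phi_lin : linear Phi.
  move=> a u v; rewrite -[u]quotmod_reprK -[v]quotmod_reprK.
  by rewrite -linearP !PhiE -linearP -linearP.
pose Phi_linear : {linear quotmod SM -> quotmod SN} :=
  HB.pack Phi (GRing.isLinear.Build _ _ _ _ Phi Phi_lin).
exists Phi_linear; exists Psi => u; rewrite -[u]quotmod_reprK /=.
  by rewrite PhiE PsiE phiK.
by rewrite PsiE PhiE psiK.
Qed.

Lemma scale_quotmod_pi (R : pzRingType) (M : lmodType R) (N : submodClosed M) a (v : M) :
  a *: quotmod_pi N v = quotmod_pi N (a *: v).
Proof. by rewrite linearZ. Qed.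

Lemma linear_eigen (R : pzRingType) (M N : lmodType R) (phi : {linear M -> N})
    (a b : R) (v : M) : a *: v = b *: v -> a *: phi v = b *: phi v.
Proof. by move=> av; rewrite -!linearZ_LR av. Qed.

Section Hrep.
Variables (F : fieldType) (q : F) (f g : {poly F}).

(** The generators x, y, h act on words letter by letter, and every element of
    H_q(f,g) acts as a combination of words. *)
Lemma intertwiner_linear (r1 r2 : hrep q f g)
    (phi : {linear hspace r1 -> hspace r2}) :
    (forall v, phi (opx r1 v) = opx r2 (phi v)) ->
    (forall v, phi (opy r1 v) = opy r2 (phi v)) ->
    (forall v, phi (oph r1 v) = oph r2 (phi v)) ->
  linear (phi : hmod r1 -> hmod r2).
Proof.
move=> phix phiy phih a u v.
have phiw w x : phi (wact w x) = wact w (phi x).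
  elim: w => //= i w <-.
  by rewrite /opl; case: (val i) => [|[|?]].
rewrite [LHS](raddfD phi); congr (_ + _).
rewrite -[a]HreprK [_ *: u]hactE [RHS]hactE /freeact [LHS](raddf_sum phi).
by apply: eq_bigr => w _; rewrite [LHS](linearZ_LR phi) phiw.
Qed.

Section Quotient.
Variables (r : hrep q f g) (N : submodClosed (hmod r)).

Lemma quotmod_scalar (c : F) (v : hspace r) :
  c%:A *: quotmod_pi N v = quotmod_pi N (c *: v).
Proof. by rewrite scale_quotmod_pi hmod_scalar. Qed.

(** The quotient carries scalars in H_q(f,g) only, so a spanning family over F is
    first read in the representation. *)
Lemma quotmod_spans (v : int -> hspace r) :
    (forall p : hspace r,
      exists (s : seq int) (a : int -> F), p = \sum_(k <- s) a k *: v k) ->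
  spans (fun i => quotmod_pi N (v i)).
Proof.
move=> v_span u; have [s [a def_u]] := v_span (repr u).
exists s, a; rewrite -[u]quotmod_reprK [repr u]def_u.
rewrite [LHS](raddf_sum (quotmod_pi N)).
by apply: eq_bigr => k _; rewrite quotmod_scalar.
Qed.

End Quotient.
End Hrep.

Lemma laurent_ideal_tpowD (F : fieldType) (n : nat) (gamma : F) (i : int) :
  tpow F (i + n%:Z) - gamma *: tpow F i \in laurent_ideal n gamma.
Proof. by apply/laurent_idealP; exists (tpow F i); rewrite mulrBr -tpowD mulr_algr. Qed.

(** * The classes of the monomials *)

Section Monomials.
Variables (F : fieldType) (q : F) (f g : {poly F}) (l : Sf f) (m : Tqg q g l).
Variables (gamma : F) (q_neq0 : q != 0).

Definition Aclass (i : int) : quotmod (Asub m gamma q_neq0) :=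
  quotmod_pi _ (Avec m (tpow F i)).

Definition Bclass (i : int) : quotmod (Bsub m gamma q_neq0) :=
  quotmod_pi _ (Bvec m (tpow F i)).

Lemma Aquot_scalar (c : F) (p : laurent F) :
  quotmod_pi (Asub m gamma q_neq0) (Avec m (c *: p)) =
  c%:A *: quotmod_pi (Asub m gamma q_neq0) (Avec m p).
Proof. exact/esym/(quotmod_scalar (r := Arep m)). Qed.

Lemma Bquot_scalar (c : F) (p : laurent F) :
  quotmod_pi (Bsub m gamma q_neq0) (Bvec m (c *: p)) =
  c%:A *: quotmod_pi (Bsub m gamma q_neq0) (Bvec m p).
Proof. exact/esym/(quotmod_scalar (r := Brep m)). Qed.

Lemma Aclass_h i : Hh q f g *: Aclass i = (l i)%:A *: Aclass i.
Proof. by rewrite scale_quotmod_pi Amod_h Aquot_scalar. Qed.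

Lemma Aclass_xy i : (Hx q f g * Hy q f g) *: Aclass i = (m i)%:A *: Aclass i.
Proof.
rewrite -scalerA scale_quotmod_pi Amod_y Aquot_scalar algscaleC; congr (_ *: _).
by rewrite scale_quotmod_pi Amod_x subrK.
Qed.

Lemma Aclass_xn i : Hx q f g ^+ totperiod m *: Aclass i = gamma%:A *: Aclass i.
Proof.
have xA j : Hx q f g *: Aclass j = 1%:A *: Aclass (j + 1).
  by rewrite !scale1r scale_quotmod_pi Amod_x.
rewrite (weighted_shift_exp (m := fun=> 1) xA) big1 // !scale1r -Aquot_scalar.
by apply/eqP; rewrite quotmod_eq; apply: laurent_ideal_tpowD.
Qed.

Lemma Bclass_spans : spans Bclass.
Proof. by apply: quotmod_spans => p; apply: laurent_span. Qed.

Lemma Bclass_h i : Hh q f g *: Bclass i = (l i)%:A *: Bclass i.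
Proof. by rewrite scale_quotmod_pi Bmod_h Bquot_scalar. Qed.

Lemma Bclass_x i : Hx q f g *: Bclass i = (m (i + 1))%:A *: Bclass (i + 1).
Proof. by rewrite scale_quotmod_pi Bmod_x Bquot_scalar. Qed.

Lemma Bclass_xy i : (Hx q f g * Hy q f g) *: Bclass i = (m i)%:A *: Bclass i.
Proof. by rewrite -scalerA [Hy q f g *: _]scale_quotmod_pi Bmod_y Bclass_x subrK. Qed.

Lemma Bclass_xn i : Hx q f g ^+ totperiod m *: Bclass i =
  (gamma * \prod_(j < totperiod m) m j%:Z)%:A *: Bclass i.
Proof.
rewrite (weighted_shift_exp Bclass_x) (prod_period (@tqg_totperiod _ _ _ _ _ m q_neq0)).
rewrite mulrC -algscaleA; congr (_ *: _); rewrite -Bquot_scalar.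
by apply/eqP; rewrite quotmod_eq; apply: laurent_ideal_tpowD.
Qed.

End Monomials.

(** * Isomorphisms and shifts of the data *)

Section Classification.
Variables (F : fieldType) (q : F) (q_neq0 : q != 0) (f g : {poly F}).
Variables (l l' : Sf f) (m : Tqg q g l) (m' : Tqg q g l') (gamma gamma' : F).
Hypothesis gamma_neq0 : gamma != 0.

Lemma iso_shift : (0 < totperiod m)%N -> (0 < totperiod m')%N ->
    lmod_iso (quotmod (Asub m gamma q_neq0)) (quotmod (Bsub m' gamma' q_neq0)) ->
  gamma = gamma' * \prod_(j < totperiod m) m j%:Z /\
  exists r : int, (forall k, l' k = l (k + r)) /\ (forall k, m' k = m (k + r)).
Proof.
move=> N_gt0 N'_gt0 [phi phi_bij]; pose u := phi (Aclass m gamma q_neq0 0).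
have u_neq0 : u != 0.
  apply/eqP => u0; have := laurent_ideal_tpow0 N_gt0 gamma_neq0.
  rewrite -[tpow F 0]subr0 => /negP; apply.
  rewrite -[_ \in _]/(Avec m (tpow F 0) - 0 \in Asub m gamma q_neq0) -quotmod_eq.
  by apply/eqP/(bij_inj phi_bij); rewrite !linear0.
have [r [lr mr]] := joint_eigen N'_gt0 (sf_totperiod m') (@tqg_totperiod _ _ _ _ _ m' q_neq0)
  (@Bclass_spans _ _ _ _ _ m' gamma' q_neq0) (@Bclass_h _ _ _ _ _ m' gamma' q_neq0)
  (@Bclass_xy _ _ _ _ _ m' gamma' q_neq0) u_neq0
  (linear_eigen phi (Aclass_h m gamma q_neq0 0)) (linear_eigen phi (Aclass_xy m gamma q_neq0 0)).
have [l'E m'E] := orbit_eq q_neq0 N_gt0 N'_gt0 lr mr.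
split; last by exists (- r).
have N'N := totperiod_shift q_neq0 l'E m'E.
have xu := linear_eigen phi (Aclass_xn m gamma q_neq0 0).
have := spans_eigen (@Bclass_spans _ _ _ _ _ m' gamma' q_neq0)
  (@Bclass_xn _ _ _ _ _ m' gamma' q_neq0) u.
rewrite N'N xu => /eqP; rewrite -subr_eq0 -scalerBl -scalerBl => /eqP.
move/algscale_eq0/(_ u_neq0)/eqP; rewrite subr_eq0 => /eqP ->; congr (_ * _).
rewrite -[RHS](prod_period (@tqg_totperiod _ _ _ _ _ m q_neq0) (- r)).
by apply: eq_bigr => j _; rewrite m'E addrC.
Qed.

Lemma shift_iso (r : int) : (0 < totperiod m)%N ->
    gamma = gamma' * \prod_(j < totperiod m) m j%:Z ->
    (forall k, l' k = l (k + r)) -> (forall k, m' k = m (k + r)) ->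
  lmod_iso (quotmod (Asub m gamma q_neq0)) (quotmod (Bsub m' gamma' q_neq0)).
Proof.
set P := \prod_(j < _) _ => N_gt0 def_gamma l'E m'E.
have P_neq0 : P != 0 by apply: contraNneq gamma_neq0 => P0; rewrite def_gamma P0 mulr0.
have m_neq0 i : m i != 0.
  have [k [z ->]] := int_residue N_gt0 i.
  rewrite (periodic_mul (@tqg_totperiod _ _ _ _ _ m q_neq0)).
  by move/prodf_neq0: P_neq0; apply.
have [c [cS c_neq0]] := cumulative_prod m_neq0.
have cN k : c (k + (totperiod m)%:Z) = c k * P.
  by rewrite (cumulative_prodD cS) (prod_period (@tqg_totperiod _ _ _ _ _ m q_neq0)).
have N'N := totperiod_shift q_neq0 l'E m'E.
have cV k : c k = c (k - 1) * m k by rewrite -{1}[k](subrK 1) cS subrK.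
(* d and s' are the weights and the shift of the inverse map. *)
pose s (k : int) := k - r; pose s' (k : int) := k + r.
pose d (k : int) := (c (k + r))^-1.
have phi_lin : linear (wshift c s : Amod m -> Bmod m').
  apply: (@intertwiner_linear _ _ _ _ (Arep m) (Brep m') (wshift c s)) => v /=;
    rewrite !wshift_comp; apply: eq_wshift => [k|k _] /=; rewrite /s ?addrA //.
  - by rewrite mulr1 m'E (_ : _ + r = k + 1) ?[1 + k]addrC ?cS 1?mulrC //; lia.
  - by rewrite mul1r [RHS]cV [-1 + k]addrC.
  - by rewrite l'E subrK mulrC.
pose phi : {linear Amod m -> Bmod m'} :=
  HB.pack (wshift c s : Amod m -> Bmod m') (GRing.isLinear.Build _ _ _ _ _ phi_lin).
have phiS p : p \in laurent_ideal (totperiod m) gamma ->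
    (wshift c s p : laurent F) \in laurent_ideal (totperiod m') gamma'.
  rewrite N'N; apply: laurent_ideal_wshift_scaled def_gamma cN _ p => k.
  by rewrite /s addrAC.
have psiS p : p \in laurent_ideal (totperiod m') gamma' ->
    (wshift d s' p : laurent F) \in laurent_ideal (totperiod m) gamma.
  rewrite N'N; apply: (@laurent_ideal_wshift_scaled _ _ _ _ P^-1) => [|k|k].
  - by rewrite def_gamma mulfK.
  - by rewrite /d addrAC cN invfM.
  by rewrite /s' addrAC.
apply: (@quotmod_iso _ _ _ _ _ phi (wshift d s' : Bmod m' -> Amod m)) => v /=.
- rewrite wshift_comp -[RHS]wshift1; apply: eq_wshift => [k|k _] /=.
    by rewrite /d /s subrK mulVf.
  by rewrite /s /s' subrK.
- rewrite wshift_comp -[RHS]wshift1; apply: eq_wshift => [k|k _] /=.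
    by rewrite /d /s' mulfV.
  by rewrite /s /s' addrK.
- exact: phiS.
- exact: psiS.
Qed.

End Classification.

Unset Implicit Arguments.
Set Strict Implicit.

Theorem proposition3p25 (F : closedFieldType) (q : F) (q_neq0 : q != 0)
    (f g : {poly F}) (l l' : Sf f) (m : Tqg q g l) (m' : Tqg q g l')
    (gamma gamma' : F) (gamma_neq0 : gamma != 0) (gamma'_neq0 : gamma' != 0)
    (l_ge1 : (1 <= period l)%N) (l'_ge1 : (1 <= period l')%N)
    (m_ge1 : (1 <= tperiod m)%N) (m'_ge1 : (1 <= tperiod m')%N) :
  lmod_iso (quotmod (Asub m gamma q_neq0)) (quotmod (Bsub m' gamma' q_neq0))
  <->
  gamma = gamma' * \prod_(j < period l * tperiod m) m j%:Z /\
  exists i j : nat, [/\ (i < period l)%N, (j < tperiod m)%N,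
    forall k : int, l' k = l (k + i%:Z) &
    forall k : int, m' k = m (k + i%:Z + j%:Z * (period l)%:Z)].
Proof.
have N_gt0 : (0 < totperiod m)%N by rewrite muln_gt0 l_ge1.
have N'_gt0 : (0 < totperiod m')%N by rewrite muln_gt0 l'_ge1.
have l_period k (z : int) : l (k + z * (period l)%:Z) = l k.
  by apply/esym; have /periodP -> : ((period l)%:Z %| z * (period l)%:Z)%Z
    by apply: dvdz_mull.
split=> [/(iso_shift gamma_neq0 N_gt0 N'_gt0)[gammaE [r [l'E m'E]]] |].
  split=> //.
  have [s [z def_r]] := int_residue N_gt0 r.
  (* The shift is only relevant modulo |lambda||mu|; its digits in base |lambda|
     are i and j. *)
  have s_divn : s%:Z = (s %% period l)%N%:Z + (s %/ period l)%N%:Z * (period l)%:Z.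
    by rewrite [in LHS](divn_eq s (period l)) PoszD PoszM addrC.
  exists (s %% period l)%N, (s %/ period l)%N; split=> [||k|k].
  - by rewrite ltn_mod.
  - by rewrite ltn_divLR // mulnC.
  - rewrite l'E def_r addrA (periodic_mul (sf_totperiod m)).
    by rewrite s_divn addrA l_period.
  - rewrite m'E def_r addrA (periodic_mul (@tqg_totperiod _ _ _ _ _ m q_neq0)).
    by rewrite s_divn addrA.
case=> gammaE [i [j [_ _ l'E m'E]]].
apply: (shift_iso q_neq0 gamma_neq0 N_gt0 gammaE
  (r := i%:Z + j%:Z * (period l)%:Z)) => k; last by rewrite addrA.
by rewrite addrA l_period.
Qed.
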